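(* (1) For every uncountable cardinal $\kappa$, every $\kappa$-distributive forcing is $(\omega,\kappa)$-predistributive. (2) Let $\Sigma=\langle\kappa_n:n<\omega\rangle$ be a non-decreasing sequence of regular uncountable cardinals. Every $\Sigma$-Prikry forcing is $(\omega,\sup\Sigma)$-predistributive.
   Context: Conventions: $q\le p$ means $q$ is stronger than $p$; $\mathbb{P}/p=\{q\in\mathbb{P}:q\le p\}$. $\mathcal{F}(\mathbb{P})$ is the family (filter) of dense open (dense and downward closed) subsets of $\mathbb{P}$. $\mathbb{P}$ is $\kappa$-distributive if every function from some $\gamma<\kappa$ to $V$ in a generic extension by $\mathbb{P}$ belongs to the ground model (equivalently, the intersection of fewer than $\kappa$ dense open sets is dense). $\mathbb{P}$ is $(\omega,\kappa)$-predistributive if for each $p\in\mathbb{P}$ and each sequence $\langle D_\alpha:\alpha<\gamma\rangle$ of members of $\mathcal{F}(\mathbb{P})$ with $\gamma<\kappa$, there are $q\le p$ and a sequence $\langle d_n:n<\omega\rangle$ of members of $\mathcal{F}(\mathbb{P}/q)$ such that for each $\alpha<\gamma$ there is $n<\omega$ with $d_n\subseteq D_\alpha$. $\Sigma$-Prikry forcing (the properties recalled by the paper): $\mathbb{P}$ is equipped with a surjection $\ell:\mathbb{P}\to\omega$ such that $p\le q$ implies $\ell(p)\ge\ell(q)$, and for every $p\in\mathbb{P}$ there is $q\le p$ with $\ell(q)=\ell(p)+1$. Writing $p\le^*q$ iff $p\le q$ and $\ell(p)=\ell(q)$, and $\mathbb{P}_m=\{p:\ell(p)=m\}$, the poset $(\mathbb{P}_m,\le^*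 )$ is $\kappa_n$-closed (every $\le^*$-decreasing sequence of length $<\kappa_n$ has a lower bound) whenever $m\ge n$. Strong Prikry Property: with $\mathbb{P}^q_{\ge m}=\{p\le q:\ell(p)\ge m\}$, for all $D\in\mathcal{F}(\mathbb{P})$ and $p\in\mathbb{P}$ there are $q\le^*p$ and $m<\omega$ such that $\mathbb{P}^q_{\ge m}\subseteq D$. *)

(* Defs.v *)
From mathcomp Require Import all_boot all_order.
From mathcomp Require Import boolp classical_sets functions cardinality wochoice.

Set Implicit Arguments.
Unset Strict Implicit.
Unset Printing Implicit Defensive.

Import Order.TTheory.
Local Open Scope classical_set_scope.
Local Open Scope card_scope.
Local Open Scope order_scope.

(* Ordinals are represented as the elements of a well-ordered type [O]: an
   element [a] stands for the ordinal that is the order type of [below a].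
   Every ordinal arises in this way, for a suitable [O].  A sequence
   of length [g] with values in [T] is a function [O -> T] of which only the
   values on [below g] are ever taken into account. *)
Section Ordinals.
Context {dO : Order.disp_t} {O : orderType dO}.
Implicit Types (a b g kappa : O).

Definition below kappa : set O := [set a | a < kappa].

Definition is_cardinal kappa : Prop :=
  forall g, g < kappa -> ~ (below kappa #<= below g).

Definition uncountable_cardinal kappa : Prop :=
  is_cardinal kappa /\ ~ countable (below kappa).

(* No function from some [g < kappa] to [kappa] is cofinal. *)
Definition regular_cardinal kappa : Prop :=
  [/\ is_cardinal kappa, infinite_set (below kappa) &
      forall g (f : O -> O), g < kappa ->
        (forall a, a < g -> f a < kappa) ->
        exists2 b, b < kappa & forall a, a < g -> f a < b].

End Ordinals.

Section Forcing.
Context {dP : Order.disp_t} {P : preorderType dP}.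
Implicit Types (p q r : P) (A D : set P).

Definition cone p : set P := [set q | q <= p].

(* [A] is regarded as a suborder of [P]. *)
Definition dense_in A D : Prop :=
  forall p, A p -> exists2 q, (A `&` D) q & q <= p.

Definition dense_open_in A D : Prop :=
  [/\ D `<=` A, dense_in A D & forall p q, D p -> A q -> q <= p -> D q].

Definition dense_open D : Prop := dense_open_in [set: P] D.

Context {dO : Order.disp_t} {O : orderType dO}.

Definition omega_predistributive (kappa : O) : Prop :=
  forall p (g : O) (D : O -> set P), g < kappa ->
    (forall a, a < g -> dense_open (D a)) ->
    exists2 q, q <= p &
      exists2 d : nat -> set P,
        (forall n, dense_open_in (cone q) (d n)) &
        (forall a, a < g -> exists n, d n `<=` D a).

(* For preorders that are not separative this is stronger than adding no new
   sequences of length less than [kappa]. *)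
Definition distributive (kappa : O) : Prop :=
  forall (g : O) (D : O -> set P), g < kappa ->
    (forall a, a < g -> dense_open (D a)) ->
    dense_in [set: P] (\bigcap_(a in below g) D a).

Definition closed_order A (R : P -> P -> Prop) (kappa : O) : Prop :=
  forall (g : O) (s : O -> P), g < kappa ->
    (forall a, a < g -> A (s a)) ->
    (forall a b, a < b -> b < g -> R (s b) (s a)) ->
    exists2 r, A r & forall a, a < g -> R r (s a).

Definition direct_le (ell : P -> nat) p q : Prop := p <= q /\ ell p = ell q.

Definition level (ell : P -> nat) (m : nat) : set P := [set p | ell p = m].

Definition above_level (ell : P -> nat) q (m : nat) : set P :=
  [set p | p <= q /\ (m <= ell p)%N].

Record sigma_prikry (Sigma : nat -> O) (ell : P -> nat) : Prop := {
  ell_surj : set_surj [set: P] [set: nat] ell;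
  ell_anti : forall p q, p <= q -> (ell q <= ell p)%N;
  ell_step : forall p, exists2 q, q <= p & ell q = (ell p).+1;
  level_closed : forall n m, (n <= m)%N ->
    closed_order (level ell m) (direct_le ell) (Sigma n);
  strong_prikry_property : forall D p, dense_open D ->
    exists2 q, direct_le ell q p & exists m, above_level ell q m `<=` D }.

End Forcing.

Arguments omega_predistributive {dP} P {dO O} kappa.
Arguments distributive {dP} P {dO O} kappa.

(* Main.v *)
Require Import Defs.
From mathcomp Require Import all_boot all_order.
From mathcomp Require Import boolp classical_sets functions cardinality wochoice.

(** For a distributive poset, one dense open set suffices: the intersection
    of all the [D a] is dense open, and its trace below [p] serves as every
    [d n].

    For a Sigma-Prikry poset, let [g] be less than the supremum of [Sigma],
    so that [g < Sigma n] for some [n].  Only the levels from [n] on are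
    closed enough for sequences of length [g], so [p] is first extended to a
    condition of length at least [n].  On the level reached, the direct order
    is [Sigma n]-closed, and by the Strong Prikry Property every condition has
    a direct extension [q] such that, for some [m], all the conditions
    below [q] of length at least [m] lie in [D a].  Hence a construction of
    length [g], handling one [D a] at each step (lemma
    [closed_order_fusion]), produces one condition [q] that works for all the
    [D a] simultaneously, with [m] depending on [a].  The dependence on [a] is
    now confined to a natural number: the countably many sets
    [above_level ell q m] are dense open below [q], and each [D a] contains
    one of them. *)

Set Implicit Arguments.
Unset Strict Implicit.
Unset Printing Implicit Defensive.

Import Order.TTheory.
Local Open Scope classical_set_scope.
Local Open Scope order_scope.

Lemma well_order_wf (dO : Order.disp_t) (O : orderType dO) :
  well_order (<=%O : rel O) -> well_founded (fun a b : O => a < b).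
Proof.
move=> wo_O a; apply: contrapT => nAcc_a.
have [|b [[]]] := wo_O [pred x : O | `[< ~ Acc (fun a b : O => a < b) x >]].
  by exists a; apply/asboolP.
move=> /asboolP nAcc_b b_min _; apply: nAcc_b.
constructor=> c lt_cb; apply: contrapT => nAcc_c.
have : b <= c by apply: b_min; apply/asboolP.
by rewrite leNgt lt_cb.
Qed.

(** Dependent choice along a well-order.  The relation takes a total function
    rather than the initial segment already built, which spares dependent
    types; the second hypothesis recovers that it sees that segment only. *)
Lemma transfinite_dependent_choice (dO : Order.disp_t) (O : orderType dO)
    (T : choiceType) (t0 : T) (Q : O -> (O -> T) -> T -> Prop) :
  well_founded (fun a b : O => a < b) ->
  (forall a s s' x, (forall b, b < a -> s b = s' b) -> Q a s x -> Q a s' x) ->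
  (forall a s, (forall b, b < a -> Q b s (s b)) -> exists x, Q a s x) ->
  exists s : O -> T, forall a, Q a s (s a).
Proof.
move=> wfO Q_local Q_step.
pose extend (a : O) (rec : forall b : O, b < a -> T) (b : O) : T :=
  if b < a =P true is ReflectT lt_ba then rec b lt_ba else t0.
pose s := Fix wfO (fun _ => T) (fun a rec => xget t0 (Q a (extend a rec))).
have sE a : s a = xget t0 (Q a (extend a (fun b _ => s b))).
  apply: (Fix_eq wfO (fun _ => T)) => {}a rec rec' eq_rec.
  congr (xget t0 (Q a (extend a _))).
  by apply: functional_extensionality_dep => b;
     apply: functional_extensionality_dep => lt_ba; apply: eq_rec.
have extendE a b : b < a -> extend a (fun b _ => s b) b = s b.
  by rewrite /extend; case: eqP.
exists s => a; elim/(well_founded_ind wfO): a => a IHa.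
rewrite sE; apply: (Q_local _ (extend a (fun b _ => s b))) => [b /extendE//|].
apply: xgetPex; have [x Qx] := Q_step a s IHa; exists x.
by apply: Q_local Qx => b /extendE.
Qed.

Section Fusion.
Context {dO : Order.disp_t} {O : orderType dO}.
Context {dP : Order.disp_t} {P : preorderType dP}.
Variables (A : set P) (R : P -> P -> Prop) (kappa : O).
Hypotheses (R_refl : forall p, R p p)
  (R_trans : forall q p r, R p q -> R q r -> R p r)
  (A_closed : closed_order A R kappa).

(** For a nonempty sequence the bound below [p] is automatic; the point is to
    include the empty one, whose lower bounds need not be related to [p]. *)
Lemma closed_order_below (p : P) (g : O) (s : O -> P) :
  A p -> g < kappa ->
  (forall a, a < g -> A (s a) /\ R (s a) p) ->
  (forall a b, a < b -> b < g -> R (s b) (s a)) ->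
  exists2 r, A r & R r p /\ forall a, a < g -> R r (s a).
Proof.
move=> Ap lt_g sAp s_decr.
have [[a0 lt_a0]|g_empty] := pselect (exists a, a < g).
  have [||r Ar rs] := A_closed lt_g (s := s) => //; first by move=> a /sAp[].
  exists r => //; split=> //; apply: R_trans (rs _ lt_a0) _.
  by have [] := sAp _ lt_a0.
by exists p => //; split=> // a lt_ag; case: g_empty; exists a.
Qed.

(** Meet the requirements [E a] one after the other along a decreasing
    sequence: closure gives a bound to start each step from, limit steps
    included, and finally a bound of the whole sequence. *)
Lemma closed_order_fusion (g : O) (E : O -> set P) (p : P) :
  well_founded (fun a b : O => a < b) -> g < kappa ->
  (forall a q, a < g -> A q -> exists2 r, A r & R r q /\ E a r) -> A p ->
  exists2 r, A r & R r p /\ forall a, a < g -> exists2 q, E a q & R r q.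
Proof.
move=> wfO lt_g E_step Ap.
pose Q a (s : O -> P) q :=
  a < g -> [/\ A q, R q p, forall b, b < a -> R q (s b) & E a q].
have [|a s IH|s Qs] := transfinite_dependent_choice (T := P) p (Q := Q) wfO.
- move=> a s s' x eq_s + lt_ag => /(_ lt_ag)[Ax Rxp Rxs Eax].
  by split=> // b lt_ba; rewrite -eq_s//; apply: Rxs.
- have [lt_ag|nlt_ag] := boolP (a < g); last first.
    by exists p; rewrite /Q (negPf nlt_ag).
  have lt_bg b : b < a -> b < g by move=> /lt_trans; apply.
  have [|||r Ar [rp rs]] := closed_order_below (g := a) (s := s) Ap.
  + exact: lt_trans lt_ag lt_g.
  + by move=> b lt_ba; have [] := IH _ lt_ba (lt_bg _ lt_ba).
  + move=> b c lt_bc lt_ca.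
    by have [_ _ + _] := IH _ lt_ca (lt_bg _ lt_ca); apply.
  have [q Aq [qr Eaq]] := E_step a r lt_ag Ar.
  exists q => _; split=> //; first exact: R_trans qr rp.
  by move=> b /rs; apply: R_trans qr.
have [|||r Ar [rp rs]] := closed_order_below (g := g) (s := s) Ap => //.
- by move=> a lt_ag; have [] := Qs a lt_ag.
- by move=> a b lt_ab lt_bg; have [_ _ + _] := Qs b lt_bg; apply.
exists r => //; split=> // a lt_ag; exists (s a); last exact: rs.
by have [] := Qs a lt_ag.
Qed.

End Fusion.

Section Predistributivity.
Context {dO : Order.disp_t} {O : orderType dO}.
Context {dP : Order.disp_t} {P : preorderType dP}.

Lemma distributive_omega_predistributive (kappa : O) :
  distributive P kappa -> omega_predistributive P kappa.
Proof.
move=> distrP p g D lt_g D_do; exists p; first exact: lexx.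
exists (fun _ => cone p `&` \bigcap_(a in below g) D a); last first.
  by move=> a lt_ag; exists 0 => q [_]; apply.
move=> _; split=> [q []//|q q_p|q r [q_p Dq] r_p le_rq].
- have [r [_ Dr] le_rq] := distrP g D lt_g D_do q I.
  have r_p : cone p r := le_trans le_rq q_p.
  by exists r.
- split=> // a lt_ag; have [_ _ D_open] := D_do a lt_ag.
  by apply: D_open (Dq a lt_ag) _ le_rq.
Qed.

Lemma direct_le_refl (ell : P -> nat) p : direct_le ell p p.
Proof. by split=> //; apply: lexx. Qed.

Lemma direct_le_trans (ell : P -> nat) q p r :
  direct_le ell p q -> direct_le ell q r -> direct_le ell p r.
Proof.
move=> [le_pq ell_pq] [le_qr ell_qr].
by split; [exact: le_trans le_pq le_qr | rewrite ell_pq].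
Qed.

Variables (Sigma : nat -> O) (ell : P -> nat).
Hypothesis spP : sigma_prikry Sigma ell.

Lemma extend_to_level (m : nat) (p : P) :
  exists2 q, q <= p & (m <= ell q)%N.
Proof.
elim: m => [|m [q le_qp le_mq]]; first by exists p; first exact: lexx.
have [r le_rq ell_r] := ell_step spP q.
by exists r; [exact: le_trans le_rq le_qp | rewrite ell_r].
Qed.

Lemma above_level_dense_open (q : P) (m : nat) :
  dense_open_in (cone q) (above_level ell q m).
Proof.
split=> [p []//|p p_q|p r [_ le_mp] r_q le_rp].
- have [r le_rp le_mr] := extend_to_level m p.
  have r_q : r <= q := le_trans le_rp p_q.
  by exists r.
- by split=> //; apply: leq_trans le_mp (ell_anti spP le_rp).
Qed.

Lemma sigma_prikry_omega_predistributive (sup_Sigma : O) :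
  well_founded (fun a b : O => a < b) ->
  supremums (range Sigma) sup_Sigma -> omega_predistributive P sup_Sigma.
Proof.
move=> wfO [_ sup_least] p g D lt_g D_do.
have [n lt_gn] : exists n, g < Sigma n.
  apply: contrapT => g_ub; move: lt_g; rewrite ltNge => /negP; apply.
  apply: sup_least => _ [n _ <-]; rewrite leNgt; apply/negP => lt_gn.
  by apply: g_ub; exists n.
have [p' le_p'p le_np'] := extend_to_level n p.
have [||q _ [[le_qp' _] q_fusion]] :=
  closed_order_fusion (@direct_le_refl ell) (@direct_le_trans ell)
    (level_closed spP le_np') wfO lt_gn
    (E := fun a => [set q | exists m, above_level ell q m `<=` D a]) (p := p').
- move=> a q lt_ag ell_q.
  have [r rq Dr] := strong_prikry_property spP q (D_do a lt_ag).
  by exists r => //; case: rq => _; rewrite /level /= ell_q.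
- by [].
exists q; first exact: le_trans le_qp' le_p'p.
exists (above_level ell q); first exact: above_level_dense_open.
move=> a /q_fusion[r [m Dr] [le_qr _]]; exists m => x [le_xq le_mx].
by apply: Dr; split=> //; apply: le_trans le_xq le_qr.
Qed.

End Predistributivity.

Theorem proposition4p2 (dO : Order.disp_t) (O : orderType dO)
    (wo_O : well_order (<=%O : rel O)) :
  (forall (kappa : O), uncountable_cardinal kappa ->
     forall (dP : Order.disp_t) (P : preorderType dP),
       distributive P kappa -> omega_predistributive P kappa)
  /\
  (forall (Sigma : nat -> O) (sup_Sigma : O),
     (forall m n : nat, (m <= n)%N -> Sigma m <= Sigma n) ->
     (forall n, regular_cardinal (Sigma n)) ->
     (forall n, uncountable_cardinal (Sigma n)) ->
     supremums (range Sigma) sup_Sigma ->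
     forall (dP : Order.disp_t) (P : preorderType dP) (ell : P -> nat),
       sigma_prikry Sigma ell -> omega_predistributive P sup_Sigma).
Proof.
split=> [kappa _ dP P|Sigma sup_Sigma _ _ _ supS dP P ell spP].
  exact: distributive_omega_predistributive.
exact: sigma_prikry_omega_predistributive spP _ (well_order_wf wo_O) supS.
Qed.
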